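(* Let $n$ be any positive integer and let $P$ be a mutation-infinite connected quiver with $n$ vertices. Then there exist infinitely many pairs $(Q,k)$ with $Q\in\mathrm{Mut}(P)$ and $k\in\{1,\dots,n\}$ such that every $c$-vector $(x_1,\dots,x_n)$ of $Q$ obtained from any reduced mutation sequence not starting with $k$ is a solution to a quadratic equation of the form $$\sum_{i=1}^n x_i^2+\sum_{1\le i<j\le n}\pm q_{ij}x_ix_j=1$$ (for some choice of the signs $\pm$), where $q_{ij}$ is the number of arrows between the vertices $i$ and $j$ in $Q$.
   Context: A quiver on the vertex set $\{1,\dots,n\}$ (no loops, no oriented 2-cycles) is identified with an $n\times n$ skew-symmetric integer matrix $B=[b_{ij}]$: if $b_{ij}>0$ there are $b_{ij}$ arrows from $i$ to $j$. Mutation: for an $n\times 2n$ integer matrix $M=[m_{ij}]$ and $k\in\{1,\dots,n\}$, the mutation of $M$ at $k$ is the matrix with entries $-m_{ij}$ if $i=k$ or $j=k$, and $m_{ij}+\mathrm{sgn}(m_{ik})\max(m_{ik}m_{kj},0)$ otherwise. A mutation sequence $\boldsymbol{w}=[i_1,\dots,i_\ell]$ (possibly empty) means mutating at $i_1$, then $i_2$, etc.; it is reduced if $i_j\ne i_{j+1}$ for all $j$. Starting from $[B\mid I]$, the result after $\boldsymbol{w}$ is written $[B^{\boldsymbol{w}}\mid C^{\boldsymbol{w}}]$; the rows $c_1^{\boldsymbol{w}},\dots,c_n^{\boldsymbol{w}}$ of $C^{\boldsymbol{w}}$ are the $c$-vectors of $B$ (of the corresponding quiver) obtained from $\boldsymbol{w}$.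 $\mathrm{Mut}(P)$ is the set of quivers $B^{\boldsymbol{w}}$ obtained from $P$ by mutation sequences; $P$ is mutation-infinite if $\mathrm{Mut}(P)$ is infinite. *)

(* Defs.v *)
From mathcomp Require Import all_boot all_order all_algebra.
From mathcomp Require Import classical_sets cardinality.

Set Implicit Arguments.
Unset Strict Implicit.
Unset Printing Implicit Defensive.

Import Order.TTheory GRing.Theory Num.Theory.

Local Open Scope ring_scope.
Local Open Scope classical_set_scope.

(* B i j > 0 means B i j arrows from i to j.  Skew-symmetry over int already
   forces a zero diagonal (no loops); 2-cycles cannot be encoded. *)
Definition is_quiver n (B : 'M[int]_n) : Prop := B^T = - B.

Definition adjacent n (B : 'M[int]_n) : rel 'I_n := [rel i j | B i j != 0].

Definition connected_quiver n (B : 'M[int]_n) : Prop :=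
  forall i j : 'I_n, connect (adjacent B) i j.

(* The column with (1-based) index k <= n of an n x 2n matrix is lshift n k. *)
Definition mutation n (M : 'M[int]_(n, n + n)) (k : 'I_n) : 'M[int]_(n, n + n) :=
  \matrix_(i, j)
    if (i == k) || (j == lshift n k) then - M i j
    else M i j + Num.sg (M i (lshift n k))
                 * Num.max (M i (lshift n k) * M k j) 0.

(* [B^w | C^w]: mutate [B | I] at the entries of w, from left to right. *)
Definition framed_mutation n (B : 'M[int]_n) (w : seq 'I_n) : 'M[int]_(n, n + n) :=
  foldl (@mutation n) (row_mx B 1%:M) w.

Definition Bmat n (B : 'M[int]_n) (w : seq 'I_n) : 'M[int]_n :=
  lsubmx (framed_mutation B w).

Definition Cmat n (B : 'M[int]_n) (w : seq 'I_n) : 'M[int]_n :=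
  rsubmx (framed_mutation B w).

Definition cvector n (B : 'M[int]_n) (w : seq 'I_n) (i : 'I_n) : 'rV[int]_n :=
  row i (Cmat B w).

Definition reduced n (w : seq 'I_n) : bool := sorted [rel i j | i != j] w.

Definition Mut n (P : 'M[int]_n) : set 'M[int]_n :=
  [set Q | exists w : seq 'I_n, Q = Bmat P w].

Definition mutation_infinite n (P : 'M[int]_n) : Prop := infinite_set (Mut P).

(* s i j = true selects the sign - for the pair i < j. *)
Definition quadratic_form n (Q : 'M[int]_n) (s : 'I_n -> 'I_n -> bool)
    (x : 'rV[int]_n) : int :=
  \sum_(i < n) x 0 i ^+ 2
  + \sum_(i < n) \sum_(j < n | (i < j)%N)
      (-1) ^+ s i j * `|Q i j| * x 0 i * x 0 j.

(* Main.v *)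
Require Import Defs.
From mathcomp Require Import all_boot all_order all_algebra zify ring.
From mathcomp Require Import classical_sets cardinality.
From mathcomp Require boolp.

Import Order.TTheory GRing.Theory Num.Theory.

Local Open Scope ring_scope.

Set Implicit Arguments.
Unset Strict Implicit.

(* The pairs [(Q, k)] are the forks [Q] of Warkentin with point of return [k]: all pairs of vertices
   carry at least two arrows, [Q] without [k] is acyclic, and every path [i -> k -> j] is closed by
   strictly more arrows [j -> i] than those on the path.  Mutating a fork anywhere but at its point
   of return [k] gives a fork whose point of return is the mutated vertex; mutating at [j] as above
   moreover gives a larger maximal edge, so one fork yields infinitely many.

   Existence.  An infinite mutation class has unbounded entries, hence an edge [r -> o] of weight
   at least 3.  Mutating at [r] and [o] alternately makes all their neighbours [v] fit into a cycle
   [r -> o -> v -> r] with large weights.  If some vertex is adjacent to neither, mutate at a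
   neighbour of [r], [o] adjacent to such a vertex; this keeps the weight of the edge between [r]
   and [o] at least 3 and gives the pair more neighbours.  In the end only the arrows among the
   other vertices are arbitrary, and mutating at each of these vertices [t] and then at [o] turns
   them one by one into part of a fork.

   c-vectors.  Along a mutation sequence [w] that never returns, the quiver stays a fork and the
   c-vectors keep a definite sign: off the point of return [k], which leaves an acyclic quiver, no
   arrow goes from a negative to a positive vertex.  A symmetric form with diagonal 2 and with
   entries [+- q_ij], chosen according to the first letter of [w], has the same shape [+- b_ij] in
   the basis of c-vectors at each step, because mutation acts on the c-vectors it changes as the
   reflection in the mutated one.  So every c-vector has norm 2. *)

(** * Mutation of the two blocks of a framed quiver *)

Section MutationRules.
Variable n : nat.
Implicit Types (B C : 'M[int]_n) (w : seq 'I_n).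

(** The pivot column lies in the left block, so [B] mutates by itself and drives the mutation of
    [C]. *)
Definition mutB B (k : 'I_n) : 'M[int]_n :=
  \matrix_(i, j)
    if (i == k) || (j == k) then - B i j
    else B i j + Num.sg (B i k) * Num.max (B i k * B k j) 0.

Definition mutC B C (k : 'I_n) : 'M[int]_n :=
  \matrix_(i, j)
    if i == k then - C i j
    else C i j + Num.sg (B i k) * Num.max (B i k * C k j) 0.

Lemma oppmE B i j : (- B) i j = - B i j.
Proof. by rewrite mxE. Qed.

Lemma mutation_row_mx B C k :
  mutation (row_mx B C) k = row_mx (mutB B k) (mutC B C k).
Proof.
apply/matrixP => i j; rewrite mxE.
case: (split_ordP j) => j' ->.
- by rewrite (inj_eq (@lshift_inj _ _)) !row_mxEl !mxE.
- by rewrite eq_rlshift orbF !row_mxEl !row_mxEr !mxE.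
Qed.

Definition mutBC (BC : 'M[int]_n * 'M[int]_n) k := (mutB BC.1 k, mutC BC.1 BC.2 k).

Lemma framed_mutationE B w :
  framed_mutation B w =
  row_mx (foldl mutBC (B, 1%:M) w).1 (foldl mutBC (B, 1%:M) w).2.
Proof.
rewrite /framed_mutation; move: (1%:M : 'M[int]_n) => C.
by elim: w B C => [|k w IHw] B C //=; rewrite mutation_row_mx IHw.
Qed.

Lemma foldl_mutBC1 BC w : (foldl mutBC BC w).1 = foldl mutB BC.1 w.
Proof. by elim: w BC => //= k w IHw BC; rewrite IHw. Qed.

Lemma BmatE B w : Bmat B w = foldl mutB B w.
Proof. by rewrite /Bmat framed_mutationE row_mxKl foldl_mutBC1. Qed.

Lemma CmatE B w : Cmat B w = (foldl mutBC (B, 1%:M) w).2.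
Proof. by rewrite /Cmat framed_mutationE row_mxKr. Qed.

Lemma quiver_skew B : is_quiver B -> forall i j, B i j = - B j i.
Proof. by move=> skB i j; move/matrixP/(_ j i): skB; rewrite !mxE. Qed.

Lemma mutB_quiver B k : is_quiver B -> is_quiver (mutB B k).
Proof.
move=> /quiver_skew skB; apply/matrixP => i j; rewrite !mxE orbC.
case: ifP => _; first by rewrite (skB j i).
rewrite (skB j i) (skB j k) (skB k i); nia.
Qed.

Lemma mutBkl B k j : mutB B k k j = - B k j.
Proof. by rewrite mxE eqxx. Qed.

Lemma mutBkr B k i : mutB B k i k = - B i k.
Proof. by rewrite mxE eqxx orbT. Qed.

Lemma mutB_path B k i j :
  0 < B i k -> 0 < B k j -> i != k -> j != k -> mutB B k i j = B i j + B i k * B k j.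
Proof.
move=> ik kj ik' jk'; rewrite mxE (negPf ik') (negPf jk') /= gtr0_sg // mul1r.
by rewrite max_l // ltW // mulr_gt0.
Qed.

Lemma mutB_same B k i j :
  B i k * B k j <= 0 -> i != k -> j != k -> mutB B k i j = B i j.
Proof.
move=> le0 ik' jk'; rewrite mxE (negPf ik') (negPf jk') /=.
by rewrite max_r // mulr0 addr0.
Qed.

Lemma mutB_opp B k : mutB (- B) k = - mutB B k.
Proof.
apply/matrixP => i j; rewrite !mxE; case: ifP => // _.
by rewrite mulrNN sgrN mulNr opprD.
Qed.

Lemma mutC_opp B C k : mutC (- B) (- C) k = - mutC B C k.
Proof.
apply/matrixP => i j; rewrite !mxE; case: ifP => // _.
by rewrite mulrNN sgrN mulNr opprD.
Qed.

End MutationRules.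

(** * Forks *)

Section Forks.
Variable n : nat.
Implicit Types (B : 'M[int]_n).

(** As every two vertices are joined, acyclicity away from [r] amounts to transitivity of the
    arrows. The vertex [r] may be a source or a sink. *)
Definition fork B (r : 'I_n) : Prop :=
  [/\ is_quiver B,
      forall i j, i != j -> 2 <= `|B i j|,
      forall i j, 0 < B i r -> 0 < B r j -> B i r < B j i /\ B r j < B j i
    & forall x y z, x != r -> y != r -> z != r ->
        0 < B x y -> 0 < B y z -> 0 < B x z].

Lemma skew_neq B x y : is_quiver B -> 0 < B x y -> x != y.
Proof. by move=> /quiver_skew skB xy; apply/eqP => e; move: xy (skB x y); rewrite e; lia. Qed.

(** If neither end is [r], transitivity already gives arrows [x -> y]. If one end is [r], opposing
    arrows lie on a path through [r] closed by the other arrow at [t], so they are fewer than those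
    and the product of the two weights outweighs them. *)
Lemma fork_path B r t x y : fork B r -> t != r -> 0 < B x t -> 0 < B t y ->
  B x t < mutB B t x y /\ B t y < mutB B t x y.
Proof.
move=> [qB abB retB trB] tr xt ty.
have skB := quiver_skew qB.
have ext := skew_neq qB xt; have ety := skew_neq qB ty.
rewrite mutB_path // 1?eq_sym //.
have := abB _ _ ext; have := abB _ _ ety.
have [exr|xr] := eqVneq x r; [|have [eyr|yr] := eqVneq y r].
- subst x; have yr : y != r by apply/eqP => e; have := skB r t; rewrite e in ty; lia.
  have := abB _ _ yr; have := skB r y.
  have [yr'|yr'|->] := ltrgtP (B y r) 0; last lia; first nia.
  by have [] := retB _ _ yr' xt; nia.
- subst y; have := abB _ _ xr; have rx := skB r x.
  have [xr'|xr'|->] := ltrgtP (B x r) 0; last lia; last nia.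
  by have [|] := retB t x ty; first lia; nia.
- have := trB _ _ _ xr tr yr xt ty; nia.
Qed.

(** Otherwise the path [y -> r -> t] would have to be closed by arrows [t -> y]. *)
Lemma fork_return_source B r t y : fork B r -> t != r ->
  0 < B r t -> 0 < B y t -> y != r -> 0 < B r y.
Proof.
move=> [qB abB retB trB] tr rt yt yr; have skB := quiver_skew qB.
have := abB _ _ yr; have := skB y r; have := skB y t.
have [ry|//|->] := ltrgtP (B r y) 0; last lia.
have [|+ _] := retB y t _ rt; first by rewrite skB; lia.
lia.
Qed.

Lemma fork_return_sink B r t y : fork B r -> t != r ->
  0 < B t r -> 0 < B t y -> y != r -> 0 < B y r.
Proof.
move=> [qB abB retB trB] tr rt yt yr; have skB := quiver_skew qB.
have := abB _ _ yr; have := skB y r; have := skB y t.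
have [ry|//|->] := ltrgtP (B y r) 0; last lia.
have [|+ _] := retB t y rt; first by rewrite skB; lia.
lia.
Qed.

(** Split the other vertices into in- and out-neighbours of [t]. Arrows within a side are kept, and
    there [r] is a source or a sink, so each side stays acyclic; by [fork_path], arrows across lead
    from the in-side to the out-side and close the new paths through [t]. *)
Lemma fork_mut B r t : fork B r -> t != r -> fork (mutB B t) t.
Proof.
move=> fB tr; have [qB abB retB trB] := fB; have skB := quiver_skew qB.
have qB' := mutB_quiver t qB; have skB' := quiver_skew qB'.
have path x y := @fork_path B r t x y fB tr.
have same x y : x != t -> y != t -> 0 < B x t * B y t -> mutB B t x y = B x y.
  by move=> xt yt xyt; rewrite mutB_same // (skB t y); lia.
have side x : x != t -> 0 < B x t \/ 0 < B t x.
  by move=> xt; have := abB _ _ xt; have := skB t x; lia.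
split => //.
- move=> i j ij; have [eit|it] := eqVneq i t.
    by rewrite eit mutBkl normrN abB // -eit.
  have [->|jt] := eqVneq j t; first by rewrite mutBkr normrN abB.
  have [iN|iN] := side _ it; have [jN|jN] := side _ jt.
  + by rewrite same ?abB // mulr_gt0.
  + by have := path _ _ iN jN; have := abB _ _ it; lia.
  + by rewrite skB'; have := path _ _ jN iN; have := abB _ _ it; lia.
  + by rewrite same ?abB // (skB i t) (skB j t) mulrNN mulr_gt0.
- move=> i j; rewrite mutBkr mutBkl => it tj.
  by have [||] := path j i; have := skB t i; have := skB j t; lia.
- have out_in x y : x != t -> y != t -> 0 < mutB B t x y -> 0 < B t x -> 0 < B t y.
    move=> xt yt xy xO; have [yN|//] := side _ yt.
    by have := path _ _ yN xO; have := skB' x y; have := skB t x; lia.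
  have asym u v : 0 < B u v -> 0 < B v u -> False
    by have := skB u v; lia.
  move=> x y z xt yt zt xy yz.
  have [xN|xN] := side _ xt; have [zN|zN] := side _ zt.
  + have [yN|yO] := side _ yt; last first.
      by have [] := asym _ _ zN (out_in _ _ yt zt yz yO).
    move: xy yz; rewrite !same ?mulr_gt0 // => xy yz.
    have src := @fork_return_source B r t _ fB tr.
    have [exr|xr] := eqVneq x r.
      subst x; apply: src => //; apply/eqP => e; subst z; exact: (asym _ _ xy yz).
    have [eyr|yr] := eqVneq y r.
      by subst y; have [] := asym _ _ xy (src _ yN xN xr).
    have [ezr|zr] := eqVneq z r; last exact: trB xy yz.
    by subst z; have [] := asym _ _ yz (src _ zN yN yr).
  + by have := path _ _ xN zN; lia.
  + by have [] := asym _ _ zN (out_in _ _ yt zt yz (out_in _ _ xt yt xy xN)).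
  + have yN := out_in _ _ xt yt xy xN.
    have skB2 u v : 0 < B t u -> 0 < B t v -> 0 < B u t * B v t.
      by move=> tu tv; rewrite (skB u t) (skB v t) mulrNN mulr_gt0.
    move: xy yz; rewrite !same ?skB2 // => xy yz.
    have snk := @fork_return_sink B r t _ fB tr.
    have [ezr|zr] := eqVneq z r.
      subst z; apply: snk => //; apply/eqP => e; subst x; exact: (asym _ _ xy yz).
    have [eyr|yr] := eqVneq y r.
      by subst y; have [] := asym _ _ yz (snk _ yN zN zr).
    have [exr|xr] := eqVneq x r; last exact: trB xy yz.
    by subst x; have [] := asym _ _ xy (snk _ xN yN yr).
Qed.

(** The cycle [i -> r -> j -> i] turns into [i -> j -> r -> i], through the new point of return, so
    the step can be iterated. *)
Lemma fork_grow B r i j : fork B r -> 0 < B i r -> 0 < B r j ->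
  [/\ fork (mutB B j) j, 0 < mutB B j i j, 0 < mutB B j j r
    & B j i < mutB B j r i].
Proof.
move=> fB ir rj; have [qB abB retB trB] := fB; have skB := quiver_skew qB.
have jr : j != r by rewrite eq_sym; apply: skew_neq rj.
have [ij1 ij2] := retB _ _ ir rj.
split; first exact: fork_mut jr.
- by rewrite mutBkr (skB i j); lia.
- by rewrite mutBkl (skB j r); lia.
- by have [|_] := @fork_path _ _ _ _ i fB jr rj; first lia.
Qed.

End Forks.

(** * Companion forms and signs of c-vectors *)

Section Gram.
Variables (n : nat) (A : 'M[int]_n).
Implicit Types (B C : 'M[int]_n) (e : 'I_n -> int).

Definition mxform (u v : 'rV[int]_n) : int := (u *m A *m v^T) 0 0.

Lemma mxform_comb a b u1 u2 v1 v2 :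
  mxform (u1 + a *: u2) (v1 + b *: v2) =
  mxform u1 v1 + b * mxform u1 v2 + a * mxform u2 v1 + a * b * mxform u2 v2.
Proof.
rewrite /mxform !(linearD, linearZ, mulmxDl) /= -!(scalemxAl, scalemxAr) !mxE; ring.
Qed.

Definition gram C i j : int := mxform (row i C) (row j C).

Lemma gram_sym C i j : A^T = A -> gram C i j = gram C j i.
Proof.
have trE (M : 'M[int]_1) : M 0 0 = M^T 0 0 by rewrite mxE.
by move=> A_sym; rewrite /gram /mxform trE !trmx_mul trmxK A_sym mulmxA.
Qed.

Lemma gram_opp C i j : gram (- C) i j = gram C i j.
Proof. have rowN k : row k (- C) = - row k C by apply/rowP => a; rewrite !mxE.
by rewrite /gram /mxform !rowN !mulNmx [in LHS]linearN mulmxN opprK. Qed.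

Lemma gram1 i j : gram 1%:M i j = A i j.
Proof. by rewrite /gram /mxform !row1 -rowE trmx_delta -colE !mxE. Qed.

(** The value -2 expresses the negation of row [t] as adding a multiple of row [t], so that one
    formula covers all rows. *)
Definition mut_coef B (t i : 'I_n) : int :=
  if i == t then -2 else Num.max (B i t) 0.

Lemma mutC_nonneg B C t i j : (forall j, 0 <= C t j) ->
  mutC B C t i j = C i j + mut_coef B t i * C t j.
Proof.
move=> Ct; rewrite mxE /mut_coef; case: eqP => [->|_]; first lia.
have := Ct j; have [Bit|Bit|->] := ltrgtP (B i t) 0; nia.
Qed.

Lemma row_mutC B C t i : (forall j, 0 <= C t j) ->
  row i (mutC B C t) = row i C + mut_coef B t i *: row t C.
Proof.
move=> Ct; apply/rowP => j.
by rewrite [LHS]mxE mutC_nonneg // [RHS]mxE [in RHS]mxE ![in RHS]mxE.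
Qed.

Lemma gram_mut B C t i j : (forall j, 0 <= C t j) ->
  gram (mutC B C t) i j =
    gram C i j + mut_coef B t j * gram C i t + mut_coef B t i * gram C t j
    + mut_coef B t i * mut_coef B t j * gram C t t.
Proof. by move=> Ct; rewrite /gram !row_mutC // mxform_comb. Qed.

End Gram.

(** * Propagation of signs and Gram matrices along mutations of a fork *)

Section Seeds.
Variables (n : nat) (A : 'M[int]_n).
Hypothesis A_sym : A^T = A.
Implicit Types (B C : 'M[int]_n) (e : 'I_n -> int).
Local Notation G := (gram A).

Definition sign_vector e := forall i, e i = 1 \/ e i = -1.

(* [e] records the signs of the rows of [C].  By [seed_return], the rows that a mutation can add to
   row [k] with the opposite sign absorb it, so that row [k] then changes sign as a whole. *)
Record fork_seed B C (k : 'I_n) e : Prop := ForkSeed {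
  seed_fork : fork B k;
  seed_sign : sign_vector e;
  seed_coherent : forall i j, 0 <= e i * C i j;
  seed_order : forall i j, i != k -> j != k -> 0 < B i j -> e j = 1 -> e i = 1;
  seed_return : forall i, B k i * e k < 0 ->
    e i = - e k /\ forall j, 0 <= e i * (C i j + C k j);
  seed_gram_diag : forall i, G C i i = 2;
  seed_gram : forall i j, i != j -> i != k -> j != k ->
    G C i j = - (e i * e j * `|B i j|);
  seed_gram_return : forall i, i != k -> G C k i = - (e i * B k i) }.

(** Negation commutes with mutation, which reduces the mutation at a negative row to that at a
    positive one. *)
Lemma fork_seed_opp B C k e :
  fork_seed B C k e -> fork_seed (- B) (- C) k (fun i => - e i).
Proof.
case=> [[qB abB retB trB]] sg coh ord ret gd g gr; have skB := quiver_skew qB.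
split=> [|i|i j|i j ik jk|i|i|i j ij ik jk|i ik]; rewrite ?gram_opp ?oppmE ?mulrNN //.
- split=> [|i j|i j|x y z xr yr zr].
  + by rewrite /is_quiver linearN /= qB.
  + by rewrite oppmE normrN; apply: abB.
  + by rewrite !oppmE => ir rj; have [||] := retB j i; have := skB k j; have := skB i k; have := skB i j; lia.
  + by rewrite !oppmE => xy yz; have := trB z y x; have := skB x y; have := skB y z; have := skB z x; lia.
- by have := sg i; lia.
- by have := ord j i; have := skB i j; have := sg i; have := sg j; lia.
- by move=> ki; have [-> h] := ret i ki; split=> // j; rewrite !oppmE; have := h j; nia.
- by rewrite g // normrN.
- by rewrite gr //; lia.
Qed.

(* What the mutation at [t] needs; [e] is the sign vector after the mutation.  The initial seed
   satisfies it without being a [fork_seed]. *)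
Record ready B C (t : 'I_n) e : Prop := Ready {
  ready_sign : sign_vector e;
  ready_sign_t : e t = -1;
  ready_t : forall j, 0 <= C t j;
  ready_in : forall i, 0 < B i t -> e i = 1 /\ forall j, 0 <= C i j + C t j;
  ready_out : forall i j, 0 < B t i -> 0 <= e i * C i j;
  ready_order : forall i j, 0 < B t i -> 0 < B t j -> 0 < B i j -> e j = 1 -> e i = 1;
  ready_diag : forall i, G C i i = 2;
  ready_gram_in : forall i, 0 < B i t -> G C i t = - B i t;
  ready_gram_out : forall i, 0 < B t i -> G C t i = - (e i * B t i);
  ready_in_in : forall i j, i != j -> 0 < B i t -> 0 < B j t -> G C i j = - `|B i j|;
  ready_out_out : forall i j, i != j -> 0 < B t i -> 0 < B t j ->
    G C i j = - (e i * e j * `|B i j|);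
  ready_in_out : forall i j, 0 < B i t -> 0 < B t j -> G C i j = - (e j * B i j) }.

Lemma ready_mut B C k t e : fork B k -> t != k -> ready B C t e ->
  fork_seed (mutB B t) (mutC B C t) t e.
Proof.
move=> fB tk [sg et Ct inN out ord gd git gto gii goo gio].
have [qB abB _ _] := fB; have skB := quiver_skew qB.
have fB' := fork_mut fB tk; have [qB' _ _ _] := fB'; have skB' := quiver_skew qB'.
have path x y := @fork_path n B k t x y fB tk.
have side x : x != t -> 0 < B x t \/ 0 < B t x.
  by move=> xt; have := abB _ _ xt; have := skB t x; lia.
have neq x : 0 < B x t -> x != t by apply: skew_neq.
have neq' x : 0 < B t x -> x != t by rewrite eq_sym; apply: skew_neq.
have cin x : 0 < B x t -> mut_coef B t x = B x t.
  by move=> xt; rewrite /mut_coef (negPf (neq _ xt)); lia.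
have cout x : 0 < B t x -> mut_coef B t x = 0.
  by move=> xt; rewrite /mut_coef (negPf (neq' _ xt)) skB; lia.
have ct : mut_coef B t t = -2 by rewrite /mut_coef eqxx.
have Cin x j : 0 < B x t -> mutC B C t x j = C x j + B x t * C t j.
  by move=> xt; rewrite mutC_nonneg // cin.
have Cout x j : 0 < B t x -> mutC B C t x j = C x j.
  by move=> xt; rewrite mutC_nonneg // cout // mul0r addr0.
have Ctt j : mutC B C t t j = - C t j by rewrite mxE eqxx.
have b2 x : 0 < B x t -> 2 <= B x t.
  by move=> xt; have := abB _ _ (neq _ xt); lia.
have same x y : x != t -> y != t -> 0 < B x t * B y t -> mutB B t x y = B x y.
  by move=> xt yt xyt; rewrite mutB_same // (skB t y); lia.
have same_out x y : 0 < B t x -> 0 < B t y -> mutB B t x y = B x y.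
  by move=> tx ty; rewrite same ?neq' // (skB x) (skB y t) mulrNN mulr_gt0.
have same_in x y : 0 < B x t -> 0 < B y t -> mutB B t x y = B x y.
  by move=> tx ty; rewrite same ?neq // mulr_gt0.
have gs i j : G C i j = G C j i by exact: gram_sym.
split=> //.
- move=> i j; have [->|/side[it|it]] := eqVneq i t.
  + by rewrite Ctt et; have := Ct j; lia.
  + have [-> /(_ j)] := inN _ it; rewrite Cin //.
    by have := b2 _ it; have := Ct j; nia.
  + by rewrite Cout //; apply: out.
- move=> i j it jt; have [iN|iO] := side _ it; first by case: (inN _ iN).
  have [jN|jO] := side _ jt; last by rewrite same_out //; apply: ord.
  by have := path _ _ jN iO; have := skB' i j; lia.
(* The new rows [i] and [t] add up to [C i + (B i t - 1) C t], which is at least [C i + C t] because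
   [B i t] is at least 2. *)
- move=> i; rewrite et mutBkl => ti.
  have iN : 0 < B i t by rewrite skB; lia.
  have [-> h] := inN _ iN; split=> // j; rewrite Cin // Ctt.
  by have := b2 _ iN; have := Ct j; have := h j; nia.
- move=> i; rewrite gram_mut // !gd; have [->|/side[it|it]] := eqVneq i t.
  + by rewrite ct gd; lia.
  + by rewrite cin // (gs t i) git //; ring.
  + by rewrite cout //; ring.
- move=> i j ij it jt; rewrite gram_mut // gd.
  have [iN|iO] := side _ it; have [jN|jO] := side _ jt.
  + rewrite !cin // (gs t j) !git // gii // same_in //.
    by have [-> _] := inN _ iN; have [-> _] := inN _ jN; ring.
  (* Both contributions carry the factor [- e j]; together they give [- e j] times the new weight,
     positive by [fork_path]. *)
  + rewrite (cin _ iN) (cout _ jO) gio // gto // mutB_path //.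
    have := path _ _ iN jO; rewrite mutB_path // => h; have [-> _] := inN _ iN.
    by rewrite ger0_norm; [ring | lia].
  + rewrite (cin _ jN) (cout _ iO) (gs i j) gio // (gs i t) gto // skB' normrN mutB_path //.
    have := path _ _ jN iO; rewrite mutB_path // => h; have [-> _] := inN _ jN.
    by rewrite ger0_norm; [ring | lia].
  + by rewrite !cout // goo // same_out //; ring.
- move=> i it; rewrite gram_mut // gd ct mutBkl; have [iN|iO] := side _ it.
  + by rewrite cin // (gs t i) git //; have [-> _] := inN _ iN; rewrite (skB t i); ring.
  + by rewrite cout // gto //; ring.
Qed.

(** By [seed_order], the only in-neighbour of [t] whose row can be negative is [k]. In that case
    [seed_return] says that adding row [t] makes it positive, so [e'] may give sign 1 to every
    in-neighbour. *)
Lemma seed_ready B C k t e : fork_seed B C k e -> t != k -> e t = 1 ->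
  exists e', ready B C t e'.
Proof.
case=> fB sg coh ord ret gd g gr tk et.
have [qB abB retB trB] := fB; have skB := quiver_skew qB.
have asym u v : 0 < B u v -> 0 < B v u -> False by have := skB u v; lia.
have neq x : 0 < B x t -> x != t by apply: skew_neq.
have neq' x : 0 < B t x -> x != t by rewrite eq_sym; apply: skew_neq.
have kt : k != t by rewrite eq_sym.
have coh1 x j : e x = 1 -> 0 <= C x j by move=> ex; have := coh x j; rewrite ex mul1r.
have ek_out : 0 < B t k -> e k = -1.
  move=> tk'; case: (sg k) => // ek; have [] := ret t; last by rewrite et ek.
  by rewrite ek (skB k); lia.
have src y : 0 < B k t -> 0 < B y t -> y != k -> 0 < B k y by exact: fork_return_source.
have snk y : 0 < B t k -> 0 < B t y -> y != k -> 0 < B y k by exact: fork_return_sink.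
have e_in x : x != k -> 0 < B x t -> e x = 1 by move=> xk xt; apply: (ord x t).
pose e' x := if x == t then -1 else if 0 < B x t then 1 else e x.
have E_in x : 0 < B x t -> e' x = 1.
  by move=> xt; rewrite /e' (negPf (neq _ xt)) xt.
have E_out x : 0 < B t x -> e' x = e x.
  by move=> tx; rewrite /e' (negPf (neq' _ tx)); case: ifP => // xt; case: (asym _ _ xt tx).
have gs i j : G C i j = G C j i by exact: gram_sym.
exists e'; split=> [i||j|i it|i j ti|i j ti tj|i|i it|i ti|i j ij it jt|i j ij ti tj|i j it tj].
- by rewrite /e'; case: ifP => _; [right | case: ifP => _; [left | apply: sg]].
- by rewrite /e' eqxx.
- exact: coh1.
- split=> [|j]; first exact: E_in.
  have [eik|ik] := eqVneq i k; last first.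
    by apply: addr_ge0; apply: coh1 => //; apply: e_in.
  subst i; case: (sg k) => ek; first by apply: addr_ge0; apply: coh1.
  have [|_ /(_ j)] := ret t; first by rewrite ek; lia.
  by rewrite et; lia.
- by rewrite E_out.
- rewrite !E_out // => ij; have [eik|ik] := eqVneq i k.
    subst i; have jk : j != k by rewrite eq_sym; apply: skew_neq ij.
    by have [] := asym _ _ ij (snk _ ti tj jk).
  have [ejk|jk] := eqVneq j k; last exact: ord.
  by subst j; rewrite ek_out.
- exact: gd.
- have [eik|ik] := eqVneq i k; first by subst i; rewrite gr // et; lia.
  by rewrite g ?neq // et (e_in _ ik it) gtr0_norm //; lia.
- rewrite E_out //; have [eik|ik] := eqVneq i k.
    by subst i; rewrite (gs t k) gr // et ek_out // (skB k); lia.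
  have ti' : t != i by rewrite eq_sym neq'.
  by rewrite g // et gtr0_norm //; lia.
- have [eik|ik] := eqVneq i k.
    subst i; have jk : j != k by rewrite eq_sym.
    by rewrite gr // e_in // mul1r gtr0_norm // src.
  have [ejk|jk] := eqVneq j k; last by rewrite g // !e_in //; lia.
  by subst j; rewrite (gs i k) gr // e_in // mul1r (skB i) normrN gtr0_norm // src.
- rewrite !E_out //; have [eik|ik] := eqVneq i k.
    subst i; have jk : j != k by rewrite eq_sym.
    by rewrite gr // ek_out //; have := snk _ ti tj jk; have := skB k j; nia.
  have [ejk|jk] := eqVneq j k; last by rewrite g.
  subst j; rewrite (gs i k) gr // ek_out //.
  by have := snk _ tj ti ik; have := skB k i; nia.
- rewrite E_out //; have [eik|ik] := eqVneq i k.
    subst i; have jk : j != k by apply/eqP => e0; subst j; exact: asym it tj.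
    by rewrite gr.
  have [ejk|jk] := eqVneq j k.
    by subst j; rewrite (gs i k) gr // ek_out // e_in // (skB k); lia.
  have ij : i != j by apply/eqP => e0; subst j; exact: asym it tj.
  by rewrite g // (e_in _ ik it) mul1r gtr0_norm //; apply: (trB i t j).
Qed.

Lemma fork_seed_mut B C k t e : fork_seed B C k e -> t != k ->
  exists e', fork_seed (mutB B t) (mutC B C t) t e'.
Proof.
move=> sBC tk; have fB := seed_fork sBC; case: (seed_sign sBC t) => et.
  by have [e' r] := seed_ready sBC tk et; exists e'; apply: ready_mut fB tk r.
have s' := fork_seed_opp sBC.
have [|e' r] := seed_ready s' tk; first by rewrite et opprK.
have := fork_seed_opp (ready_mut (seed_fork s') tk r).
by rewrite mutB_opp mutC_opp !opprK => s1; exists (fun i => - e' i).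
Qed.

Lemma fork_seed_foldl w B C k e : fork_seed B C k e ->
  path [rel i j | i != j] k w ->
  exists k' e', fork_seed (foldl (@mutBC n) (B, C) w).1 (foldl (@mutBC n) (B, C) w).2 k' e'.
Proof.
elim: w B C k e => [|t w IHw] B C k e s /=; first by exists k, e.
case/andP=> kt; have tk : t != k by rewrite eq_sym.
have [e' s'] := fork_seed_mut s tk; exact: IHw s'.
Qed.

End Seeds.

(** * The quadratic equation for the c-vectors of a fork *)

Section CVectors.
Variable n : nat.
Implicit Types (A B C Q : 'M[int]_n) (w : seq 'I_n).

Lemma mxform_diag A (x : 'rV[int]_n) : A^T = A -> (forall i, A i i = 2) ->
  mxform A x x =
    2 * (\sum_(i < n) x 0 i ^+ 2
         + \sum_(i < n) \sum_(j < n | (i < j)%N) A i j * x 0 i * x 0 j).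
Proof.
move=> A_sym A2; pose F i j := A i j * x 0 i * x 0 j.
have -> : mxform A x x = \sum_(i < n) \sum_(j < n) F i j.
  rewrite /mxform mxE exchange_big; apply: eq_bigr => j _ /=.
  rewrite !mxE mulr_suml; apply: eq_bigr => i _; rewrite /F; ring.
have FC i j : F i j = F j i by rewrite /F -[in LHS]A_sym mxE; ring.
have -> : \sum_(i < n) \sum_(j < n) F i j =
    \sum_(i < n) F i i + \sum_(i < n) \sum_(j < n | (i < j)%N) F i j
    + \sum_(i < n) \sum_(j < n | (j < i)%N) F i j.
  rewrite -!big_split; apply: eq_bigr => i _ /=.
  rewrite (bigD1 i) //= (bigID (fun j : 'I_n => (i < j)%N)) /= addrA.
  congr (_ + _ + _); apply: eq_bigl => j; first by rewrite andb_idl // -val_eqE => /gtn_eqF ->.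
  by rewrite -leqNgt ltn_neqAle val_eqE.
rewrite [X in _ + _ + X](exchange_big_dep predT) //=.
under [X in _ + _ + X]eq_bigr do under eq_bigr do rewrite FC.
under eq_bigr do rewrite /F A2.
have -> : \sum_(i < n) 2 * x 0 i * x 0 i = 2 * \sum_(i < n) x 0 i ^+ 2.
  by rewrite mulr_sumr; apply: eq_bigr => i _; ring.
ring.
Qed.

Lemma quadratic_form_companion A Q (x : 'rV[int]_n) :
  A^T = A -> (forall i, A i i = 2) -> (forall i j, i != j -> `|A i j| = `|Q i j|) ->
  2 * quadratic_form Q (fun i j => A i j < 0) x = mxform A x x.
Proof.
move=> A_sym A2 AQ; rewrite mxform_diag //; congr (_ * (_ + _)).
apply: eq_bigr => i _; apply: eq_bigr => j ij; congr (_ * _ * _).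
rewrite -AQ; last by rewrite neq_ltn ij.
by rewrite -numEsign.
Qed.

(* The quasi-Cartan companion of a fork in which every 3-cycle is admissible, its vertex signs
   being normalised so that [t] is ready to be mutated. *)
Definition companion B (t : 'I_n) : 'M[int]_n :=
  \matrix_(i, j)
    if i == j then 2
    else if (0 < B i t) && (0 < B t j) then - B i j
    else if (0 < B j t) && (0 < B t i) then - B j i
    else - `|B i j|.

Lemma companion_sym B t : is_quiver B -> (companion B t)^T = companion B t.
Proof.
move=> /quiver_skew skB; apply/matrixP => i j; rewrite !mxE [j == i]eq_sym.
have := skB i t; have := skB j t; rewrite (skB j i) normrN.
by case: eqP => // _; case: ifP; case: ifP => //; lia.
Qed.

Lemma companion_diag B t i : companion B t i i = 2.
Proof. by rewrite mxE eqxx. Qed.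

Lemma companion_norm B t i j : is_quiver B -> i != j -> `|companion B t i j| = `|B i j|.
Proof.
move=> /quiver_skew skB ij; rewrite mxE (negPf ij) (skB j i).
by case: ifP => _; [|case: ifP => _]; rewrite !normrN ?normr_id.
Qed.

(** With all rows positive, [ready_in_out] prescribes the entry [- B i j] along a path
    [i -> t -> j]; this is the case distinction made in [companion]. *)
Lemma ready_initial B k t : fork B k -> t != k ->
  ready (companion B t) B 1%:M t (fun i => if i == t then -1 else 1).
Proof.
move=> [qB _ _ _] tk; have skB := quiver_skew qB.
have Btt : B t t = 0 by have := skB t t; lia.
have nin i : 0 < B i t -> (i == t) = false.
  by move=> it; apply/negbTE/(skew_neq qB it).
have nout i : 0 < B t i -> (i == t) = false.
  by move=> ti; rewrite eq_sym; apply/negbTE/(skew_neq qB ti).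
have id0 i j : 0 <= (1%:M : 'M[int]_n) i j by rewrite mxE; case: eqP.
have Nin i : 0 < B i t -> (0 < B t i) = false by have := skB t i; lia.
have Nout i : 0 < B t i -> (0 < B i t) = false by have := skB t i; lia.
split=> [i||j|i it|i j ti|i j ti tj|i|i it|i ti|i j ij it jt|i j ij ti tj|i j it tj];
  rewrite ?gram1 ?companion_diag //=.
- by case: eqP; [right | left].
- by rewrite eqxx.
- by rewrite nin //; split=> // j; rewrite addr_ge0.
- by rewrite nout // mul1r.
- by rewrite !nout.
- by rewrite mxE nin // Btt ltxx andbF gtr0_norm.
- by rewrite mxE eq_sym nout // Btt ltxx andbF gtr0_norm // mul1r.
- by rewrite mxE (negPf ij) !Nin // !andbF.
- by rewrite mxE (negPf ij) !Nout //= !nout // !mul1r.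
- rewrite mxE it tj /= nout // mul1r.
  by case: eqP => // eij; subst j; rewrite Nin in tj.
Qed.

Lemma fork_cvector Q k w i : fork Q k -> reduced w -> ohead w != Some k ->
  exists s, quadratic_form Q s (cvector Q w i) = 1.
Proof.
move=> fQ; have [qQ _ _ _] := fQ; rewrite /cvector CmatE => red hd.
(* For empty [w] the default [i] serves, since then only the diagonal of [A] matters. *)
pose t := head i w; pose A := companion Q t.
exists (fun i j => A i j < 0).
suff : gram A (foldl (@mutBC n) (Q, 1%:M) w).2 i i = 2.
  rewrite /gram -(@quadratic_form_companion A Q).
  - by move=> h; apply: (mulfI (_ : (2 : int) != 0)); rewrite ?h.
  - exact: companion_sym.
  - exact: companion_diag.
  - by move=> *; apply: companion_norm.
case: w red hd @t @A => [|t w] /= red hd.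
  by rewrite gram1 companion_diag.
have tk : t != k by apply: contraNneq hd => ->.
have A_sym := companion_sym t qQ.
have s0 := ready_mut A_sym fQ tk (ready_initial fQ tk).
by have [k' [e' /seed_gram_diag]] := fork_seed_foldl A_sym s0 red.
Qed.

End CVectors.

(** * Alternating mutations at two vertices *)

Section RankTwo.
Variable m : int.
Hypothesis m_ge3 : 3 <= m.

(* [xy] stands for [(B o v, B v r)], and [m] for [B r o]; see [mutB_alt]. *)
Definition alt (xy : int * int) : int * int :=
  if 0 < xy.1 then (m * xy.1 - xy.2, xy.1) else (- xy.2, xy.1).

(** From such a pair on, [alt] stays in its first branch and the first component strictly
    increases. *)
Definition stable (xy : int * int) : bool := (0 < xy.1) && (xy.2 <= xy.1).

(** The vertex [v] then closes a cycle [r -> o -> v -> r] with heaviest edge [o -> v], as in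
    [pf_cycle]. *)
Definition large (xy : int * int) : bool := [&& m < xy.1, xy.2 < xy.1 & 2 <= xy.2].

Lemma alt_large xy : large xy -> large (alt xy).
Proof. by rewrite /large /alt; case: xy => x y /= ?; case: ifP => /= ?; nia. Qed.

Lemma iter_large N xy : large xy -> large (iter N alt xy).
Proof. by move=> h; elim: N => //= N; apply: alt_large. Qed.

Lemma stable_large xy : stable xy -> exists N, large (iter N alt xy).
Proof.
move: xy => [x y]; have [k] : exists k : nat, m + 1 - x <= k%:Z by exists (absz (m + 1 - x)%R); lia.
elim: k x y => [|k IHk] x y xk /andP[/= x0 yx].
all: have altE : alt (x, y) = (m * x - y, x) by rewrite /alt /= x0.
  (* As [y] may be less than 2, one more step moves [x] into the second place. *)
  by exists 1%N; rewrite /= altE /large /=; nia.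
have [||N hN] := IHk (m * x - y) x; [nia | by rewrite /stable /=; nia |].
by exists N.+1; rewrite iterSr altE.
Qed.

(** On a nonpositive first component [alt] is a quarter turn, and at most three of these suffice. *)
Lemma alt_stable_nonpos x y : x <= 0 -> (x, y) != (0, 0) ->
  exists N, stable (iter N alt (x, y)).
Proof.
rewrite xpair_eqE => x0 xy0.
have step u v : u <= 0 -> alt (u, v) = (- v, u) by rewrite /alt /= ltNge => ->.
have neg u v : u <= 0 -> v < 0 -> stable (alt (u, v)).
  by move=> u0 v0; rewrite step // /stable /=; lia.
have neg2 u v : u < 0 -> exists N, stable (iter N alt (u, v)).
  move=> u0; have [v0|v0] := ltP v 0; first by exists 1%N; apply: neg; lia.
  by exists 2%N; rewrite /= step ?neg //; lia.
have [/neg2|x0'] := ltP x 0; first exact.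
have [y0|y0] := ltP y 0; first by exists 1%N; apply: neg.
have [|N hN] := neg2 (- y) x; first by lia.
by exists N.+1; rewrite iterSr step.
Qed.

(** In the remaining case [0 < x < y], the second component drops from [y] to [x], whence the
    induction on its absolute value. *)
Lemma alt_stable xy : xy != (0, 0) -> exists N, stable (iter N alt xy).
Proof.
case: xy => x y; move: {2}(absz y) (leqnn (absz y)) => k.
elim: k x y => [|k IHk] x y yk xy0; (have [x0|x0] := leP x 0; first exact: alt_stable_nonpos).
  by exists 0%N; rewrite /stable /=; lia.
have [yx|xy] := leP y x; first by exists 0%N; rewrite /stable /= x0.
have altE : alt (x, y) = (m * x - y, x) by rewrite /alt /= x0.
have [||N hN] := IHk (m * x - y) x; [lia | by rewrite xpair_eqE; lia |].
by exists N.+1; rewrite iterSr altE.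
Qed.

End RankTwo.

(** * Making all vertices adjacent to a heavy edge *)

Section Existence.
Variable n : nat.
Implicit Types (B : 'M[int]_n) (r o v z : 'I_n) (T : {set 'I_n}).

Definition reach B B' := exists w : seq 'I_n, B' = foldl (@mutB n) B w.

Lemma reach_refl B : reach B B.
Proof. by exists [::]. Qed.

Lemma reach_mut B B' k : reach B B' -> reach B (mutB B' k).
Proof. by case=> w ->; exists (rcons w k); rewrite foldl_rcons. Qed.

Lemma reach_trans B1 B2 B3 : reach B1 B2 -> reach B2 B3 -> reach B1 B3.
Proof. by case=> w -> [w' ->]; exists (w ++ w'); rewrite foldl_cat. Qed.

Lemma adjacent_sym B : is_quiver B -> symmetric (adjacent B).
Proof. by move=> /quiver_skew skB i j; rewrite /adjacent /= skB oppr_eq0. Qed.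

(** An edge can only vanish between two neighbours of [k], and these stay joined through [k]. *)
Lemma mutB_connected B k : is_quiver B -> connected_quiver B -> connected_quiver (mutB B k).
Proof.
move=> qB conB; have symB := adjacent_sym (mutB_quiver k qB).
have toK i : B i k != 0 -> connect (adjacent (mutB B k)) i k.
  by move=> ik; apply: connect1; rewrite /adjacent /= mutBkr oppr_eq0.
have edge i j : adjacent B i j -> connect (adjacent (mutB B k)) i j.
  rewrite /adjacent /= => ij; have [eik|ik] := eqVneq i k.
    by apply: connect1; rewrite /adjacent /= eik mutBkl oppr_eq0 -eik.
  have [ejk|jk] := eqVneq j k; first by rewrite ejk; apply: toK; rewrite -ejk.
  have [le0|gt0] := leP (B i k * B k j) 0.
    by apply: connect1; rewrite /adjacent /= mutB_same.
  have [ik0 kj0] : B i k != 0 /\ B k j != 0.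
    by split; apply: contraTneq gt0 => ->; rewrite ?mul0r ?mulr0.
  apply: connect_trans (toK _ ik0) _; rewrite (sym_connect_sym symB); apply: toK.
  by rewrite (quiver_skew qB) oppr_eq0.
by move=> i j; apply: connect_sub (conB i j).
Qed.

Lemma reach_quiver B B' : reach B B' -> is_quiver B -> is_quiver B'.
Proof. by case=> w ->; elim: w B => //= k w IHw B /(mutB_quiver k)/IHw. Qed.

Lemma reach_connected B B' : reach B B' -> is_quiver B -> connected_quiver B ->
  connected_quiver B'.
Proof.
case=> w ->; elim: w B => //= k w IHw B qB cB.
by apply: IHw; [exact: mutB_quiver | exact: mutB_connected].
Qed.

Lemma crossing_edge B T r z : is_quiver B -> connected_quiver B -> r \notin T -> z \in T ->
  exists x y, [/\ x \notin T, y \in T & B x y != 0].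
Proof.
move=> qB conB rT zT.
have [/existsP[x /existsP[y /and3P[? ? ?]]]|noedge] :=
  boolP [exists x, exists y, [&& x \notin T, y \in T & B x y != 0]].
  by exists x, y.
have clT : closed (adjacent B) T.
  have csym := sym_connect_sym (adjacent_sym qB).
  apply: (intro_closed csym) => x y xy xT.
  apply: contraNT noedge => yT; apply/existsP; exists y; apply/existsP; exists x.
  by rewrite yT xT /= (quiver_skew qB) oppr_eq0.
by have := closed_connect clT (conB r z); rewrite zT (negPf rT).
Qed.

(** The mutation turns [r -> o] into [o -> r], so the new pair is read with [r] and [o]
    exchanged. *)
Lemma mutB_alt B r o v : is_quiver B -> 0 < B r o -> v != r -> v != o ->
  (mutB B o r v, mutB B o v o) = alt (B r o) (B o v, B v r).
Proof.
move=> qB ro vr vo; have skB := quiver_skew qB; have ro' := skew_neq qB ro.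
rewrite /alt /= mutBkr (skB v o) opprK; case: ltP => ov.
  by rewrite mutB_path // (skB r v) addrC.
by rewrite mutB_same // 1?(skB r v) //; nia.
Qed.

Definition pair_eq r o r' o' := (r' = r /\ o' = o) \/ (r' = o /\ o' = r).

Lemma iter_mutB_alt N B r o : is_quiver B -> 0 < B r o ->
  exists B' r' o', [/\ reach B B', B' r' o' = B r o, pair_eq r o r' o' &
    forall v, v != r -> v != o -> (B' o' v, B' v r') = iter N (alt (B r o)) (B o v, B v r)].
Proof.
move=> qB ro; elim: N => [|N [B' [r' [o' [rB eB pB hB]]]]].
  by exists B, r, o; split=> //; [exact: reach_refl | left].
have qB' := reach_quiver rB qB; exists (mutB B' o'), o', r'; split.
- exact: reach_mut.
- by rewrite mutBkl -(quiver_skew qB').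
- by case: pB => -[-> ->]; [right | left].
- move=> v vr vo; rewrite /= -hB // -eB mutB_alt ?eB //.
  + by case: pB => -[-> _].
  + by case: pB => -[_ ->].
Qed.

Lemma make_large B r o : is_quiver B -> 3 <= B r o ->
  exists B' r' o', [/\ reach B B', B' r' o' = B r o, pair_eq r o r' o' &
    forall v, v != r -> v != o ->
      (B o v, B v r) = (0, 0) /\ (B' o' v, B' v r') = (0, 0)
      \/ large (B r o) (B' o' v, B' v r')].
Proof.
move=> qB m3; set m := B r o.
have exN v : exists N, (B o v, B v r) != (0, 0) -> large m (iter N (alt m) (B o v, B v r)).
  have [_|nz] := eqVneq (B o v, B v r) (0, 0); first by exists 0%N.
  have [N1 h1] := alt_stable m3 nz; have [N2 h2] := stable_large m3 h1.
  by exists (N2 + N1)%N; rewrite iterD.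
have [f hf] := fin_all_exists exN.
(* Large pairs stay large, so the maximal number of steps serves all vertices at once. *)
have [|B' [r' [o' [rB eB pB hB]]]] := @iter_mutB_alt (\max_v f v) B r o qB; first by lia.
exists B', r', o'; split=> // v vr vo; rewrite hB // -/m.
have [->|nz] := eqVneq (B o v, B v r) (0, 0); [left | right].
  by split=> //; elim: (\max_v f v) => //= N ->; rewrite /alt /= oppr0.
by rewrite -(subnK (leq_bigmax v)) iterD; apply: iter_large => //; apply: hf.
Qed.

Definition isolated B r o : {set 'I_n} :=
  [set v | [&& v != r, v != o, B o v == 0 & B v r == 0]].

Lemma all_large B r o : is_quiver B -> connected_quiver B -> 3 <= B r o ->
  exists B' r' o', [/\ reach B B', 3 <= B' r' o' &
    forall v, v != r' -> v != o' -> large (B' r' o') (B' o' v, B' v r')].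
Proof.
have [k] := ubnP #|isolated B r o|; elim: k B r o => // k IHk B r o ltk qB conB m3.
have [B1 [r1 [o1 [rB eB pB hB]]]] := make_large qB m3.
have qB1 := reach_quiver rB qB; have conB1 := reach_connected rB qB conB.
have skB1 := quiver_skew qB1.
have sub : isolated B1 r1 o1 \subset isolated B r o.
  apply/fintype.subsetP => v; rewrite !inE => /and4P[v1 v2 /eqP v3 /eqP v4].
  have [vr vo] : v != r /\ v != o by case: pB v1 v2 => -[-> ->].
  rewrite vr vo /=; case: (hB v vr vo) => [[[-> ->] _]|]; first by rewrite eqxx.
  by rewrite v3 v4 /large /=; lia.
have lrg v : v != r1 -> v != o1 -> v \notin isolated B1 r1 o1 ->
    large (B1 r1 o1) (B1 o1 v, B1 v r1).
  move=> v1 v2; rewrite inE v1 v2 /= eB => nz.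
  have [vr vo] : v != r /\ v != o by case: pB v1 v2 => -[-> ->].
  by case: (hB v vr vo) => // -[_ [e1 e2]]; rewrite e1 e2 eqxx in nz.
have [e0|[z0 z0Z]] := set_0Vmem (isolated B1 r1 o1).
  by exists B1, r1, o1; split=> [||v v1 v2]; [|rewrite eB|apply: lrg => //; rewrite e0 inE].
have [|x [z [xZ zZ xz]]] := @crossing_edge B1 _ r1 z0 qB1 conB1 _ z0Z.
  by rewrite inE eqxx.
move: (zZ); rewrite inE => /and4P[zr zo /eqP oz /eqP zr0].
have xr : x != r1 by apply: contraNneq xz => ->; rewrite skB1 zr0 oppr0.
have xo : x != o1 by apply: contraNneq xz => ->; rewrite oz.
have /and3P[/= l1 l2 l3] := lrg x xr xo xZ.
have or1 := skB1 o1 r1.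
have rx : r1 != x by rewrite eq_sym.
have ox : o1 != x by rewrite eq_sym.
have xr1 : 0 < B1 x r1 by apply: lt_le_trans l3.
have oxx : 0 < B1 o1 x by apply: lt_trans l2.
(* With [m] the weight of [r1 -> o1], the path [o1 -> x -> r1] reverses this edge and leaves weight
   at least [2 (m + 1) - m]. *)
have ge3 : 3 <= mutB B1 x o1 r1.
  rewrite mutB_path // or1 eB.
  have prod : B1 o1 x * 2 <= B1 o1 x * B1 x r1 by rewrite ler_pM2l.
  by rewrite eB in l1; clear -m3 l1 prod; lia.
have skB2 := quiver_skew (mutB_quiver x qB1).
(* The vertex [z] gains arrows to [r1] or from [o1] through [x]. Any other [v] with arrows to [r1]
   keeps them, since paths [v -> x -> r1] only add to them. *)
have iso : isolated (mutB B1 x) o1 r1 \subset isolated B1 r1 o1 :\ z.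
  apply/fintype.subsetP => v; rewrite in_setD1 inE => /and4P[vo vr h1 h2].
  rewrite skB2 oppr_eq0 in h1.
  have [evx|vx] := eqVneq v x.
    by move: h1; rewrite evx mutBkl oppr_eq0 gt_eqF.
  have [evz|vz] /= := eqVneq v z.
    subst v; have [zx|zx] := ltP 0 (B1 z x).
      by move: h1; rewrite mutB_path // zr0 add0r mulf_eq0 !gt_eqF.
    have zx' : 0 < B1 x z by rewrite lt_neqAle eq_sym xz skB1 oppr_ge0.
    by move: h2; rewrite skB2 oppr_eq0 mutB_path // oz add0r mulf_eq0 !gt_eqF.
  apply: contraLR h1 => vZ; have /and3P[/= l1' l2' l3'] := lrg v vr vo vZ.
  have vr1 : 0 < B1 v r1 by apply: lt_le_trans l3'.
  have [vx0|vx0] := ltP 0 (B1 v x); last first.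
    by rewrite mutB_same ?(gt_eqF vr1) //; apply: mulr_le0_ge0 => //; apply: ltW.
  by rewrite mutB_path // gt_eqF // addr_gt0 // mulr_gt0.
have [||||B2 [r2 [o2 [rB2 m2 h2]]]] := IHk (mutB B1 x) o1 r1.
- apply: leq_ltn_trans (subset_leq_card iso) _; rewrite ltnS in ltk.
  apply: leq_trans ltk; apply: leq_trans (subset_leq_card sub).
  by rewrite [X in (_ < X)%N](cardsD1 z) zZ.
- exact: mutB_quiver.
- exact: mutB_connected.
- exact: ge3.
exists B2, r2, o2; split=> //; apply: reach_trans rB2; exact: reach_mut.
Qed.

End Existence.

(** * From a heavy edge to a fork *)

(* [lia] is very slow in the presence of disequalities between vertices. *)
Ltac entry_lia :=
  repeat match goal with
  | H : is_true (negb _) |- _ => clear H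
  | H : is_true (_ \in _) |- _ => clear H
  end; lia.

Section PartialForks.
Variable n : nat.
Implicit Types (B : 'M[int]_n) (r o v z : 'I_n) (T : {set 'I_n}).

(* Would be a fork with point of return [r], were the arrows inside [T] not arbitrary. *)
Record partial_fork B r o T : Prop := PartialFork {
  pf_quiver : is_quiver B;
  pf_ro : 2 <= B r o;
  pf_r : r \notin T;
  pf_o : o \notin T;
  pf_cycle : forall v, v != r -> v != o ->
    [/\ 2 <= B v r, B v r < B o v & B r o < B o v];
  pf_T : forall z b, z \in T -> b \notin T -> b != r -> b != o -> 2 <= B z b;
  pf_abundant : forall b c, b != c -> b != r -> b != o -> b \notin T ->
    c != r -> c != o -> c \notin T -> 2 <= `|B b c|;
  pf_trans : forall x y z,
    [&& x != r, x != o & x \notin T] -> [&& y != r, y != o & y \notin T] ->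
    [&& z != r, z != o & z \notin T] -> 0 < B x y -> 0 < B y z -> 0 < B x z }.

(** As [t] points to all vertices outside [T] but [o], its mutation keeps the arrows among these,
    where [r] is a sink, and can only increase those from the rest of [T] to them. Afterwards [o]
    points to every vertex but [t], so the mutation at [o] affects only arrows at [o] or [t]. *)
Lemma partial_fork_mut B r o T t : partial_fork B r o T -> t \in T ->
  partial_fork (mutB (mutB B t) o) o t (T :\ t).
Proof.
case=> qB ro rT oT cyc TS ab tr tT; have skB := quiver_skew qB.
have qB1 := mutB_quiver t qB; have skB1 := quiver_skew qB1; have qB2 := mutB_quiver o qB1.
have tr' : t != r by apply: contraNneq rT => <-.
have to' : t != o by apply: contraNneq oT => <-.
have rt : r != t by rewrite eq_sym.
have ot : o != t by rewrite eq_sym.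
have ro' : r != o by apply: skew_neq qB _; entry_lia.
have or' : o != r by rewrite eq_sym.
have [tr2 trot root] := cyc t tr' to'.
have ort : 0 < B o t by entry_lia.
have trp : 0 < B t r by entry_lia.
have or1 : mutB B t o r = B o t * B t r - B r o by rewrite mutB_path // (skB o r) addrC.
have otr : B o t * 2 <= B o t * B t r by rewrite ler_pM2l.
have oV v : v != r -> v != o -> v != t ->
    B o v <= mutB B t o v /\ (0 < B t v -> mutB B t o v = B o v + B o t * B t v).
  move=> vr vo vt; have [tv|tv] := ltP 0 (B t v).
    by rewrite mutB_path //; split=> //; rewrite lerDl mulr_ge0 // ltW.
  by rewrite mutB_same ?ltNge ?tv //; apply: mulr_ge0_le0 => //; apply: ltW.
have grow u v : u != t -> v != t -> 0 < B t v -> B u v <= mutB B t u v.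
  move=> ut vt tv; have [bu|bu] := ltP 0 (B u t).
    by rewrite mutB_path // lerDl mulr_ge0 // ltW.
  by rewrite mutB_same //; apply: mulr_le0_ge0 => //; apply: ltW.
have o1 v : v != o -> v != t -> 0 < mutB B t o v.
  move=> vo vt; have [->|vr] := eqVneq v r; first by rewrite or1; entry_lia.
  by have [? ? _] := cyc v vr vo; have [? _] := oV v vr vo vt; entry_lia.
have same2 u v : u != o -> u != t -> v != o -> v != t ->
    mutB (mutB B t) o u v = mutB B t u v.
  move=> uo ut vo vt; rewrite mutB_same //.
  by rewrite skB1 mulNr oppr_le0 ltW // mulr_gt0 ?o1.
have tS b : b != r -> b != o -> b \notin T -> b != t /\ 2 <= B t b.
  by move=> br bo bT; split; [apply: contraNneq bT => -> | apply: TS].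
have same1 b c : b != r -> b != o -> b \notin T -> c != o -> c \notin T ->
    mutB B t b c = B b c.
  move=> br bo bT co cT; have [bt tb] := tS b br bo bT.
  have ct : c != t by apply: contraNneq cT => ->.
  have tc : 0 < B t c.
    by have [->|cr] := eqVneq c r; [| have [] := tS c cr co cT; entry_lia].
  rewrite mutB_same //; apply: mulr_le0_ge0; last exact: ltW.
  by rewrite skB; entry_lia.
have TD v : v != t -> (v \notin T :\ t) = (v \notin T) by move=> vt; rewrite in_setD1 vt.
split=> //.
- by rewrite mutBkl mutBkr opprK; entry_lia.
- by rewrite in_setD1 negb_and (negPf oT) orbT.
- by rewrite in_setD1 eqxx.
- move=> v vo vt; rewrite mutBkr -skB1 mutBkl mutBkr opprK.
  have to1 : mutB B t t o = B o t by rewrite mutBkl skB opprK.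
  have tv2 : mutB (mutB B t) o t v = B o t * mutB B t o v - B t v.
    by rewrite mutB_path ?o1 ?to1 // mutBkl addrC.
  (* The new weight of [t -> v] is [B o t * q - p] with [q = mutB B t o v] and [p = B t v]; from
     [p < q] and both factors at least 3 it exceeds [q] and [B o t]. *)
  have [tv1 ov3] : B t v < mutB B t o v /\ 3 <= mutB B t o v.
    have [->|vr] := eqVneq v r; first by rewrite or1; entry_lia.
    have [? ? ?] := cyc v vr vo; have [? ov] := oV v vr vo vt.
    have [tv|tv] := ltP 0 (B t v); last by entry_lia.
    have ottv : 1 * B t v <= B o t * B t v by rewrite ler_pM2r //; entry_lia.
    by rewrite (ov tv); entry_lia.
  rewrite tv2; move: (mutB B t o v) (B t v) tv1 ov3 => q p pq q3.
  have ot3 : 3 <= B o t by entry_lia.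
  by clear -pq q3 ot3; split; nia.
- move=> z b /finset.setD1P[zt zT] + bo bt; rewrite TD // => bT'.
  have zo : z != o by apply: contraNneq oT => <-.
  have zr : z != r by apply: contraNneq rT => <-.
  rewrite same2 //.
  have [->|br] := eqVneq b r; first by have [? _ _] := cyc z zr zo; have := grow z r zt rt trp; entry_lia.
  have [_ tb] := tS b br bo bT'; have := TS z b zT bT' br bo.
  by have := grow z b zt bt (lt_le_trans (ltr0Sn _ _) tb); entry_lia.
- move=> b c bc bo bt; rewrite TD // => bT co ct; rewrite TD // => cT; rewrite same2 //.
  have [ebr|br] := eqVneq b r.
    have cr : c != r by rewrite -ebr eq_sym.
    by rewrite skB1 normrN same1 // ebr; have [? _ _] := cyc c cr co; entry_lia.
  rewrite same1 //; have [->|cr] := eqVneq c r; last exact: ab.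
  by have [? _ _] := cyc b br bo; entry_lia.
- move=> x y z /and3P[xo xt +] /and3P[yo yt +] /and3P[zo zt +].
  rewrite !TD // !same2 // => xT yT zT.
  have r_sink u v : v != o -> v \notin T -> u = r -> 0 < mutB B t u v -> False.
    move=> vo vT ->; have [->|vr] := eqVneq v r; first by have := skB1 r r; entry_lia.
    by rewrite skB1 same1 //; have [? _ _] := cyc v vr vo; entry_lia.
  have [/r_sink hx|xr] := eqVneq x r; first by move=> /(hx _ yo yT).
  have [/r_sink hy|yr] := eqVneq y r; first by move=> _ /(hy _ zo zT).
  rewrite !same1 //; have [->|zr] := eqVneq z r; first by have [? _ _] := cyc x xr xo; entry_lia.
  by apply: tr; apply/and3P.
Qed.

(** Only [o] receives arrows from [r], so [pf_cycle] closes every path through [r]; away from [r],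
    the vertex [o] is a source. *)
Lemma partial_fork0 B r o : partial_fork B r o finset.set0 -> fork B r.
Proof.
case=> qB ro _ _ cyc _ ab tr; have skB := quiver_skew qB.
split=> //.
- move=> i j ij.
  have [eir|ir] := eqVneq i r.
    have [->|jo] := eqVneq j o; first by rewrite eir; entry_lia.
    have jr : j != r by rewrite -eir eq_sym.
    by have [? _ _] := cyc j jr jo; rewrite eir skB; entry_lia.
  have [ejr|jr] := eqVneq j r.
    have [->|io] := eqVneq i o; first by rewrite ejr skB; entry_lia.
    by have [? _ _] := cyc i ir io; rewrite ejr; entry_lia.
  have [eio|io] := eqVneq i o.
    by have [|? ? ?] := cyc j jr; [rewrite -eio eq_sym | rewrite eio; entry_lia].
  have [ejo|jo] := eqVneq j o; last by apply: ab; rewrite ?inE.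
  by have [? ? ?] := cyc i ir io; rewrite ejo skB; entry_lia.
- move=> i j ir rj; have ir' := skew_neq qB ir.
  have io : i != o by apply/eqP => e; have := skB r o; rewrite e in ir; entry_lia.
  have [-> |jo] := eqVneq j o; first by have [] := cyc i ir' io.
  have jr : j != r by rewrite eq_sym; apply: skew_neq rj.
  by have [? _ _] := cyc j jr jo; have := skB r j; entry_lia.
- move=> x y z xr yr zr xy yz.
  have so u v : u != r -> v = o -> 0 < B u v -> False.
    move=> ur ->; have [->|uo] := eqVneq u o; first by have := skB o o; entry_lia.
    by have [? ? ?] := cyc u ur uo; have := skB u o; entry_lia.
  have [/(so x y xr)/(_ xy)//|yo] := eqVneq y o.
  have [/(so y z yr)/(_ yz)//|zo] := eqVneq z o.
  have [->|xo] := eqVneq x o; first by have [? ? ?] := cyc z zr zo; entry_lia.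
  by apply: (tr x y z); rewrite ?xr ?yr ?zr ?xo ?yo ?zo ?inE.
Qed.

Lemma partial_fork_complete T B r o : partial_fork B r o T ->
  exists B' r' o', reach B B' /\ partial_fork B' r' o' finset.set0.
Proof.
have [k] := ubnP #|T|; elim: k T B r o => // k IHk T B r o ltk pB.
have [T0|[t tT]] := set_0Vmem T.
  by exists B, r, o; rewrite -T0; split=> //; exact: reach_refl.
have [|B' [r' [o' [rB pB']]]] := IHk _ _ _ _ _ (partial_fork_mut pB tT).
  by move: ltk; rewrite (cardsD1 t) tT.
exists B', r', o'; split=> //; apply: reach_trans rB.
by do 2 apply: reach_mut; apply: reach_refl.
Qed.

Lemma reach_fork B r o v : is_quiver B -> connected_quiver B -> 3 <= B r o ->
  v != r -> v != o ->
  exists B' r' i j, [/\ reach B B', fork B' r', 0 < B' i r' & 0 < B' r' j].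
Proof.
move=> qB conB ro vr vo.
have [B1 [r1 [o1 [rB m3 lrg]]]] := all_large qB conB ro.
have qB1 := reach_quiver rB qB.
(* With all other vertices in [T], the conditions on arrows outside [T] are vacuous. *)
pose T := [set u | (u != r1) && (u != o1)].
have outT u : u \notin T -> u != r1 -> u != o1 -> False.
  by rewrite inE => /negP uT ur uo; apply: uT; rewrite ur uo.
have [|B2 [r2 [o2 [rB2 pB2]]]] := @partial_fork_complete T B1 r1 o1.
  split=> //; rewrite ?inE ?eqxx ?andbF //; first by entry_lia.
  - by move=> u ur uo; have /and3P[/= ? ? ?] := lrg u ur uo; split=> //; entry_lia.
  - by move=> z b _ bT br bo; case: (outT b).
  - by move=> b c _ br bo bT; case: (outT b).
  - by move=> x y z /and3P[xr xo xT]; case: (outT x).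
have fB2 := partial_fork0 pB2; have [_ ro2 _ _ cyc _ _ _] := pB2.
(* Such a [u] lies on a cycle through [r2]. It exists because [r], [o], [v] are three distinct
   vertices. *)
suff [u [ur uo]] : exists u, u != r2 /\ u != o2.
  exists B2, r2, u, o2; split=> //; [exact: reach_trans rB2 | | entry_lia].
  by have [? _ _] := cyc u ur uo; entry_lia.
have /existsP[u] : [exists u, u \notin [:: r2; o2]].
  apply: contraT => /existsPn h.
  have : (#|[:: r; o; v]| <= #|[:: r2; o2]|)%N.
    by apply/subset_leq_card/fintype.subsetP => u _; have := h u; rewrite negbK.
  move/leq_trans/(_ (card_size _)); rewrite (card_uniqP _) //= !inE negb_or.
  by rewrite (skew_neq qB) ?[_ == v]eq_sym ?vr ?vo //; entry_lia.
by rewrite !inE negb_or => /andP[]; exists u.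
Qed.

Lemma fork_unbounded B r i j N : fork B r -> 0 < B i r -> 0 < B r j ->
  exists B' r' a b, [/\ reach B B', fork B' r' & N%:Z <= B' a b].
Proof.
(* The induction carries the cycle [a -> r' -> b -> a], whose closing edge grows by [fork_grow]. *)
move=> fB ir rj; suff [B' [r' [a [b [rB fB' ar rb bnd]]]]] : exists B' r' a b,
    [/\ reach B B', fork B' r', 0 < B' a r', 0 < B' r' b & N%:Z <= B' b a].
  by exists B', r', b, a.
elim: N => [|N [B' [r' [a [b [rB fB' ar rb bnd]]]]]].
  exists B, r, i, j; split=> //; first exact: reach_refl.
  by have [_ _ /(_ i j ir rj)[? _] _] := fB; entry_lia.
have [f1 f2 f3 f4] := fork_grow fB' ar rb.
by exists (mutB B' b), b, a, r'; split=> //; [exact: reach_mut | entry_lia].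
Qed.

End PartialForks.

Local Open Scope classical_set_scope.

(** * Infinitely many forks *)

Section Unbounded.
Variable n : nat.
Implicit Types P Q : 'M[int]_n.

Lemma MutE P Q : Mut P Q <-> reach P Q.
Proof. by split=> -[w ->]; exists w; rewrite BmatE. Qed.

Definition bounded_by (N : nat) Q := forall i j, (absz (Q i j) <= N)%N.

Lemma finite_bounded N : finite_set [set Q : 'M[int]_n | bounded_by N Q].
Proof.
pose f (M : 'M['I_(N + N).+1]_n) : 'M[int]_n := \matrix_(i, j) ((M i j)%:Z - N%:Z).
apply: (@sub_finite_set _ _ [set f M | M in setT]); last exact/finite_image/finite_finset.
move=> Q bQ; exists (\matrix_(i, j) inord (absz (Q i j + N%:Z))) => //.
apply/matrixP => i j; rewrite !mxE; have := bQ i j => bij.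
by rewrite inordK; lia.
Qed.

Lemma entry_bound Q : exists N, bounded_by N Q.
Proof.
exists (\max_i \max_j absz (Q i j))%N => i j.
apply: leq_trans (leq_bigmax i); exact: (leq_bigmax j).
Qed.

Lemma mutation_infinite_unbounded P N : mutation_infinite P ->
  exists Q, reach P Q /\ ~ bounded_by N Q.
Proof.
move=> infP; apply: boolp.contrapT => bnd; apply: infP.
apply: sub_finite_set (finite_bounded N) => Q /MutE rQ.
by apply: boolp.contrapT => nb; apply: bnd; exists Q.
Qed.

(** With at most two vertices, an entry off row and column [k] is diagonal, so mutations change
    signs only. *)
Lemma reach_rank2 P Q : (n <= 2)%N -> is_quiver P -> reach P Q ->
  forall i j, `|Q i j| = `|P i j|.
Proof.
move=> n2 + [w ->]; elim: w P => //= k w IHw P qP i j.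
rewrite IHw; last exact: mutB_quiver.
rewrite mxE; case: ifP => [_|]; first by rewrite normrN.
move/negbT; rewrite negb_or => /andP[ik jk].
have -> : i = j by apply/val_inj; move: ik jk; rewrite -!val_eqE /=; move: (ltn_ord i) (ltn_ord j) (ltn_ord k); lia.
have skP := quiver_skew qP; rewrite (skP k j) max_r; last by nia.
by rewrite mulr0 addr0.
Qed.

Lemma mutation_infinite_forks P N : is_quiver P -> connected_quiver P ->
  mutation_infinite P ->
  exists Q k i j, [/\ reach P Q, fork Q k & N%:Z <= Q i j].
Proof.
move=> qP cP infP; have [N0 bP] := entry_bound P.
(* Exceeding [N0] rules out [n <= 2] by [reach_rank2]; the summand 2 provides an edge of weight at
   least 3. *)
have [Q [rQ nbQ]] := mutation_infinite_unbounded (N0 + 2)%N infP.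
have qQ := reach_quiver rQ qP; have skQ := quiver_skew qQ.
have cQ := reach_connected rQ qP cP.
have [i [j ij]] : exists i j, (N0 + 2 < absz (Q i j))%N.
  apply: boolp.contrapT => h; apply: nbQ => i j; rewrite leqNgt; apply/negP => ij.
  by apply: h; exists i, j.
have n3 : (2 < n)%N.
  rewrite ltnNge; apply/negP => n2.
  by have := reach_rank2 n2 qP rQ i j; have := bP i j; lia.
have [r [o ro]] : exists r o, 3 <= Q r o.
  have [Qij|Qij] := leP 0 (Q i j); first by exists i, j; lia.
  by exists j, i; rewrite skQ; lia.
have /existsP[v] : [exists v, v \notin [:: r; o]].
  apply: contraT => /existsPn h.
  have : (#|'I_n| <= #|[:: r; o]|)%N.
    by apply/subset_leq_card/fintype.subsetP => u _; have := h u; rewrite negbK.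
  by move/leq_trans/(_ (card_size _)); rewrite card_ord /= leqNgt n3.
rewrite !inE negb_or => /andP[vr vo].
have [B [k [a [b [rB fB ak kb]]]]] := reach_fork qQ cQ ro vr vo.
have [B' [k' [c [d [rB' fB' big]]]]] := fork_unbounded N fB ak kb.
exists B', k', c, d; split=> //; exact: reach_trans rQ (reach_trans rB rB').
Qed.

End Unbounded.

Theorem theorem1p1 (n : nat) (P : 'M[int]_n)
    (n_gt0 : (0 < n)%N)
    (P_quiver : is_quiver P)
    (P_connected : connected_quiver P)
    (P_infinite : mutation_infinite P) :
  infinite_set [set Qk : 'M[int]_n * 'I_n |
    Mut P Qk.1 /\
    forall (w : seq 'I_n) (i : 'I_n),
      reduced w -> ohead w != Some Qk.2 ->
      exists s : 'I_n -> 'I_n -> bool,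
        quadratic_form Qk.1 s (cvector Qk.1 w i) = 1].
Proof.
(* Finitely many pairs would involve finitely many quivers, whose entries would have a common
   bound. *)
move=> /(finite_image fst)/finite_seqP[s sE].
have [N bnd] : exists N, forall Q, Q \in s -> bounded_by N Q.
  have [f hf] := boolp.choice (@entry_bound n).
  exists (\max_(Q <- s) f Q)%N => Q Qs i j.
  by apply: leq_trans (hf Q i j) _; apply: leq_bigmax_seq.
have [Q [k [i [j [rQ fQ big]]]]] := mutation_infinite_forks N.+1 P_quiver P_connected P_infinite.
have Qs : [set` s] Q.
  rewrite -sE; exists (Q, k) => //=; split; first exact/MutE.
  by move=> w a; apply: fork_cvector.
by have := bnd Q Qs i j; lia.
Qed.
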